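(* Let $T=(1,3,6^k,3,1)$. If $k=3$ there are exactly $52$, and if $k=4$ there are exactly $61$, potential Jordan degree types for pairs $(A,\ell)$ with $A\in\mathrm{Gor}(T)$ and $\ell\in A_1$ (equivalently, potential rank matrices for $T$).
   Context: $\mathsf{k}$ is an infinite field of arbitrary characteristic, $R=\mathsf{k}[x,y,z]$ with the standard grading; $6^k$ means $6$ repeated $k$ times. $\mathrm{Gor}(T)$ is the family of graded Artinian Gorenstein (AG) quotients $A=R/I$ with Hilbert function $T=(t_0,\dots,t_j)$; $j$ is the socle degree and $s=\max_i t_i$. For a nonzero linear form $\ell\in A_1$, the rank matrix $M_{A,\ell}$ is the $(j+1)\times(j+1)$ upper triangular matrix (indices $0,\dots,j$) with $(u,v)$ entry, $u\le v$, the rank of $\ell^{v-u}:A_u\to A_v$. A potential rank matrix for $T$ is an upper triangular $(j+1)\times(j+1)$ matrix $M$ of non-negative integers, with rows and columns indexed by $0,\dots,j$, satisfying the known necessary conditions for rank matrices: (i) writing $H(i)=(M_{0,i},M_{1,i+1},\dots,M_{j-i,j})$ for the $i$-th diagonal, $H(0)=T$, $H(1)\ne 0$, and each $H(i)$ is either zero or the Hilbert function of a graded AG quotient of $R$ of socle degree $j-i$; (ii) each difference $H(i)-(0,H(i+1))$ is an O-sequence, i.e. zero or the Hilbert function of a standard graded algebra; (iii) in the upper triangular part, rows are non-increasing from left to right and columns are non-decreasing from top to bottom; (iv) $M_{u+1,v}+M_{u,v+1}\ge M_{u,v}+M_{u+1,v+1}$ whenever $0\le u<v<j$; (v) for all $u\le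 v$ with $t_u=t_v=s$, the entry $M_{u,v}$ depends only on $v-u$. The potential Jordan degree type associated with $M$ is the multiset of pairs $(p,\nu)$ (strings of length $p$ starting in degree $\nu$) in which $(v-u+1,u)$ has multiplicity $M_{u,v}+M_{u-1,v+1}-M_{u-1,v}-M_{u,v+1}$ for $0\le u\le v\le j$ (entries with indices out of range being $0$). This correspondence between potential rank matrices and potential Jordan degree types is one-to-one; for $M=M_{A,\ell}$ it gives the actual Jordan degree type of $(A,\ell)$, i.e. the lengths and initial degrees of the strings in a decomposition of $A$ into graded cyclic $\mathsf{k}[\ell]$-modules. *)

(* Defs.v *)
From HB Require Import structures.
From mathcomp Require Import all_boot all_order all_algebra.
From mathcomp Require Import finmap multiset mpoly.

Set Implicit Arguments.
Unset Strict Implicit.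
Unset Printing Implicit Defensive.

Import GRing.Theory.

Section GradedQuotients.
Local Open Scope ring_scope.
Variables (k : fieldType) (n : nat).
Implicit Types (I V : {pred {mpoly k[n]}}) (d : nat) (h : nat -> nat).

(* idealr_closed includes 1 \notin I, so R/I is never the zero ring. *)
Definition homogeneous_ideal I : Prop :=
  idealr_closed I /\ forall d p, p \in I -> pihomog mdeg d p \in I.

(* The image of V in R/I has dimension d: some b_1, ..., b_d in V are
   linearly independent modulo I and span V modulo I. *)
Definition quot_dim V I d : Prop :=
  exists b : 'I_d -> {mpoly k[n]},
    [/\ forall i, b i \in V,
        forall c : 'I_d -> k, \sum_i c i *: b i \in I -> forall i, c i = 0
      & forall p, p \in V ->
          exists c : 'I_d -> k, p - \sum_i c i *: b i \in I].

Definition hilbert_function I h : Prop :=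
  forall d, quot_dim [pred p | p \is d.-homog] I (h d).

(* For homogeneous I, R/I is Artinian iff it is finite dimensional over k. *)
Definition artinian_quotient I : Prop := exists d, quot_dim predT I d.

(* The preimage in R of the socle of R/I, i.e. the colon ideal I : (X_i)_i. *)
Definition socle I : {pred {mpoly k[n]}} :=
  [pred p | [forall i : 'I_n, 'X_i * p \in I]].

Definition AG_ideal I : Prop :=
  [/\ homogeneous_ideal I, artinian_quotient I & quot_dim (socle I) I 1].

End GradedQuotients.

(* A finite sequence H of length j + 1 stands for the function that is
   H_0, ..., H_j in degrees 0, ..., j and 0 in degrees > j. *)
Definition is_zero_seq (H : seq nat) : bool := all (pred1 0) H.

(* H_j <> 0 says that the socle degree is exactly j. *)
Definition gorenstein_sequence (k : fieldType) (j : nat) (H : seq nat) : Prop :=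
  [/\ size H = j.+1, nth 0 H j != 0
    & exists I : {pred {mpoly k[3]}}, AG_ideal I /\ hilbert_function I (nth 0 H)].

Definition O_sequence (k : fieldType) (D : seq nat) : Prop :=
  is_zero_seq D \/
  exists (n : nat) (I : {pred {mpoly k[n]}}),
    homogeneous_ideal I /\ hilbert_function I (nth 0 D).

Section RankMatrices.
Variables (N : nat) (M : 'M[nat]_N).

(* M_{u,v}, read as 0 when an index is out of range. *)
Definition entry (u v : nat) : nat :=
  if insub u is Some i then if insub v is Some j then M i j else 0 else 0.

(* M_{u-1,v}; it is 0 for u = 0, where u.-1 would wrongly give M_{0,v}. *)
Definition entry_above (u v : nat) : nat :=
  if u is u'.+1 then entry u' v else 0.

Definition diagonal (i : nat) : seq nat :=
  mkseq (fun u => entry u (u + i)) (N - i).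

(* H(i) - (0, H(i+1)) for H(i) = diagonal i. The subtraction is exact as soon as the columns of M
   are non-decreasing from top to bottom. *)
Definition diagonal_diff (i : nat) : seq nat :=
  mkseq (fun u => nth 0 (diagonal i) u - nth 0 (0 :: diagonal i.+1) u) (N - i).

(* The subtraction is exact for potential rank matrices, by prm_rows,
   prm_columns and prm_squares below. *)
Definition string_mult (u v : nat) : nat :=
  (entry u v + entry_above u v.+1) - (entry_above u v + entry u v.+1).

(* The element (p, nu) is a string of length p starting in degree nu. *)
Definition jordan_degree_type : {mset (nat * nat)}%mset :=
  \big[@msetD _/mset0]_(u < N) \big[@msetD _/mset0]_(v < N | u <= v)
    msetn (string_mult u v) (v - u + 1, u : nat).

End RankMatrices.

(* The indices 0, ..., j are those smaller than size T = j + 1. *)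
Record potential_rank_matrix (k : fieldType) (T : seq nat)
    (M : 'M[nat]_(size T)) : Prop := PotentialRankMatrix {
  prm_upper : forall u v : 'I_(size T), v < u -> M u v = 0;
  prm_diagonal0 : diagonal M 0 = T;
  prm_diagonal1 : ~~ is_zero_seq (diagonal M 1);
  prm_gorenstein : forall i, i < size T ->
    is_zero_seq (diagonal M i) \/
    gorenstein_sequence k ((size T).-1 - i) (diagonal M i);
  prm_diff : forall i, i < size T -> O_sequence k (diagonal_diff M i);
  prm_rows : forall u v, u <= v -> v.+1 < size T ->
    entry M u v.+1 <= entry M u v;
  prm_columns : forall u v, u < v -> v < size T ->
    entry M u v <= entry M u.+1 v;
  prm_squares : forall u v, u < v -> v.+1 < size T ->
    entry M u v + entry M u.+1 v.+1 <= entry M u.+1 v + entry M u v.+1;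
  prm_plateau : forall u v u' v',
    u <= v -> v < size T -> u' <= v' -> v' < size T ->
    let s := \max_(t <- T) t in
    nth 0 T u = s -> nth 0 T v = s -> nth 0 T u' = s -> nth 0 T v' = s ->
    v - u = v' - u' -> entry M u v = entry M u' v'
}.

Definition potential_jordan_degree_type (k : fieldType) (T : seq nat)
    (J : {mset (nat * nat)}%mset) : Prop :=
  exists2 M : 'M[nat]_(size T),
    potential_rank_matrix k M & J = jordan_degree_type M.

Definition has_card (X : eqType) (P : X -> Prop) (m : nat) : Prop :=
  exists s : seq X, [/\ uniq s, size s = m & forall x, x \in s <-> P x].

Definition T_1_3_6k_3_1 (e : nat) : seq nat := [:: 1; 3] ++ nseq e 6 ++ [:: 3; 1].

(* Main.v *)
Require Import Defs.
From mathcomp Require Import all_boot all_order all_algebra.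
From mathcomp Require Import finmap multiset mpoly.
From mathcomp Require Import zify.

(** A potential rank matrix [M] is the same thing as the list of its diagonals
    [H(0) = T, H(1), H(2), ...], and the proof is a finite search over such lists.

    The search is finite because [H(i)], when nonzero, is symmetric
    ([gorenstein_hilbert_sym]: multiplication into the one-dimensional socle is a
    perfect pairing) and constant away from its two first and two last terms (the
    plateau condition).  So it has the form [(1, a, b, ..., b, a, 1)], and [a <= 3],
    [b <= 6] because the rows of [M] decrease.

    The conditions on consecutive diagonals are inequalities, except that
    [H(i) - (0, H(i+1))] has to be an O-sequence.  Three easy cases of Macaulay's
    bound, gathered in [O_growth], leave 52 lists for [k = 3] and 61 for [k = 4]:
    a graded piece of dimension zero is followed by zero, one of dimension at most
    one in positive degree by one of dimension at most one ([hilbert_le1S]), and two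
    linear generators give at most [d + 1] dimensions in degree [d]
    ([hilbert_two_generators]).

    Conversely all these lists come from potential rank matrices, which requires
    algebras with prescribed Hilbert functions over the given field.  All of them are
    quotients by a [label_ideal]: monomials carry labels, those with equal labels
    are identified, and those without a label vanish, so that the labels
    are a basis of the quotient.  When the labels are the contractions of a sum of
    dual monomials, chosen such that any two contractions are equal or disjoint, this
    is Macaulay's inverse system and the quotient is Gorenstein in every
    characteristic ([contraction_AG]); a few explicit forms ([dual_form]) yield all
    the diagonals.  When the labels are the monomials of an order ideal in two
    variables, it is a monomial quotient, and these yield all the differences
    ([plane_O_sequence]).

    Finally, a Jordan degree type determines the string multiplicities of its matrix
    ([jordan_degree_type_mult]), and these already separate the matrices found. *)

Set Implicit Arguments.
Unset Strict Implicit.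
Unset Printing Implicit Defensive.

Import GRing.Theory.

(** * Linear algebra modulo an ideal *)

Section ModuloIdeal.
Local Open Scope ring_scope.
Variables (k : fieldType) (n : nat) (I : {pred {mpoly k[n]}}).
Hypothesis idI : idealr_closed I.
Implicit Types (p q u : {mpoly k[n]}) (d : nat).

Lemma tall_kernel r s (C : 'I_r -> 'I_s -> k) : (s < r)%N ->
  exists w : 'I_r -> k, (exists i, w i != 0) /\
    forall l, \sum_i w i * C i l = 0.
Proof.
move=> lt_sr; pose A : 'M_(r, s) := \matrix_(i, l) C i l.
have /rowV0Pn[w wA w0] : kermx A != 0.
  rewrite -mxrank_eq0 mxrank_ker subn_eq0 -ltnNge.
  exact: leq_ltn_trans (rank_leq_col _) lt_sr.
exists (w 0); split=> [|l].
  apply/existsP; apply: contraR w0 => /existsPn wi0.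
  by apply/eqP/rowP => i; rewrite mxE; apply/eqP; rewrite -[_ == _]negbK wi0.
have /rowP/(_ l) := sub_kermxP wA; rewrite !mxE => {2}<-.
by apply: eq_bigr => i _; rewrite mxE.
Qed.

Lemma ideal_0 : 0 \in I.
Proof. by case: idI. Qed.

Lemma ideal_1 : 1 \notin I.
Proof. by case: idI. Qed.

Lemma ideal_mulAdd u p q : p \in I -> q \in I -> u * p + q \in I.
Proof. by case: idI => _ _ H Ip Iq; apply: H. Qed.

Lemma ideal_add p q : p \in I -> q \in I -> p + q \in I.
Proof. by move=> Ip Iq; rewrite -[p]mul1r; apply: ideal_mulAdd. Qed.

Lemma ideal_mul u p : p \in I -> u * p \in I.
Proof. by move=> Ip; rewrite -[_ * _]addr0; apply: ideal_mulAdd ideal_0. Qed.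

Lemma ideal_scale c p : p \in I -> c *: p \in I.
Proof. by rewrite -mul_mpolyC; apply: ideal_mul. Qed.

Lemma ideal_opp p : p \in I -> - p \in I.
Proof. by rewrite -scaleN1r; apply: ideal_scale. Qed.

Lemma ideal_sub p q : p \in I -> q \in I -> p - q \in I.
Proof. by move=> Ip Iq; apply: ideal_add => //; apply: ideal_opp. Qed.

Lemma ideal_sum (X : Type) (r : seq X) (P : pred X) F :
  (forall i, P i -> F i \in I) -> \sum_(i <- r | P i) F i \in I.
Proof. by move=> IF; elim/big_ind: _ => //; [apply: ideal_0|apply: ideal_add]. Qed.

Definition in_span r (f : 'I_r -> {mpoly k[n]}) p : Prop :=
  exists c : 'I_r -> k, p - \sum_i c i *: f i \in I.

Section Span.
Variables (r : nat) (f : 'I_r -> {mpoly k[n]}).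

Lemma in_span_ideal p : p \in I -> in_span f p.
Proof.
by exists (fun=> 0); rewrite big1 ?subr0 // => i _; rewrite scale0r.
Qed.

Lemma in_span_add p q : in_span f p -> in_span f q -> in_span f (p + q).
Proof.
move=> [c Ic] [e Ie]; exists (fun i => c i + e i).
under eq_bigr do rewrite scalerDl.
by rewrite big_split opprD addrACA; apply: ideal_add.
Qed.

Lemma in_span_scale a p : in_span f p -> in_span f (a *: p).
Proof.
move=> [c Ic]; exists (fun i => a * c i).
under eq_bigr do rewrite -scalerA.
by rewrite -scaler_sumr -scalerBr; apply: ideal_scale.
Qed.

Lemma in_span_sum (X : Type) (s : seq X) (P : pred X) F :
  (forall i, P i -> in_span f (F i)) -> in_span f (\sum_(i <- s | P i) F i).
Proof.
move=> FP; elim/big_ind: _ => //; first exact/in_span_ideal/ideal_0.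
exact: in_span_add.
Qed.

Lemma in_span_mem i : in_span f (f i).
Proof.
exists (fun l => (l == i)%:R); rewrite (bigD1 i) //= eqxx scale1r big1 ?addr0.
  by rewrite subrr ideal_0.
by move=> l /negPf->; rewrite scale0r.
Qed.

Lemma in_span_congr p q : p - q \in I -> in_span f q -> in_span f p.
Proof. by move=> Ipq qP; rewrite -(subrK q p); apply: in_span_add; first exact: in_span_ideal. Qed.

End Span.

Lemma in_span_trans r s (f : 'I_r -> {mpoly k[n]}) (g : 'I_s -> {mpoly k[n]}) p :
  in_span f p -> (forall i, in_span g (f i)) -> in_span g p.
Proof.
move=> [c Ic] fg; apply: in_span_congr Ic _.
by apply: in_span_sum => i _; apply: in_span_scale.
Qed.

Lemma in_span_mul r (f : 'I_r -> {mpoly k[n]}) u p :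
  in_span f p -> in_span (fun i => u * f i) (u * p).
Proof.
move=> [c Ic]; exists c; under eq_bigr do rewrite scalerAr.
by rewrite -mulr_sumr -mulrBr; apply: ideal_mul.
Qed.

(** If the spanning family were shorter, the matrix of coordinates of [f] would have
    a kernel vector, and that vector is a linear relation of [f] modulo [I]. *)
Lemma independent_le_spanning r s (f : 'I_r -> {mpoly k[n]}) (g : 'I_s -> {mpoly k[n]}) :
    (forall c : 'I_r -> k, \sum_i c i *: f i \in I -> forall i, c i = 0) ->
    (forall i, in_span g (f i)) ->
  (r <= s)%N.
Proof.
move=> f_free /fin_all_exists[C CP]; rewrite leqNgt; apply/negP => lt_sr.
have [w [[i0 /eqP w0] wC]] := tall_kernel C lt_sr; apply/w0/f_free.
have -> : \sum_i w i *: f i = \sum_i w i *: (f i - \sum_l C i l *: g l).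
  under [RHS]eq_bigr do rewrite scalerBr scaler_sumr.
  rewrite sumrB exchange_big [X in _ = _ - X]big1 ?subr0 // => l _ /=.
  under eq_bigr do rewrite scalerA.
  by rewrite -scaler_suml wC scale0r.
by apply: ideal_sum => i _; apply: ideal_scale.
Qed.

Lemma quot_dim_le_spanning (V : {pred {mpoly k[n]}}) d s (g : 'I_s -> {mpoly k[n]}) :
  quot_dim V I d -> (forall p, p \in V -> in_span g p) -> (d <= s)%N.
Proof. by move=> [b [bV bI _]] gV; apply: independent_le_spanning bI _ => i; apply/gV/bV. Qed.

Lemma quot_dim1_span (V : {pred {mpoly k[n]}}) t : quot_dim V I 1 ->
  t \in V -> t \notin I -> forall p, p \in V -> in_span (fun _ : 'I_1 => t) p.
Proof.
move=> [b [_ _ bS]] Vt It p Vp.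
have [c] := bS t Vt; have [c'] := bS p Vp; rewrite !big_ord1 => Ic' Ic.
have c0 : c 0 != 0.
  by apply: contra It => /eqP c0; move: Ic; rewrite c0 scale0r subr0.
exists (fun=> c' 0 / c 0); rewrite big_ord1.
have -> : p - c' 0 / c 0 *: t = (p - c' 0 *: b 0) - c' 0 / c 0 *: (t - c 0 *: b 0).
  by rewrite scalerBr scalerA divfK // opprB addrA subrK.
by apply: ideal_sub => //; apply: ideal_scale.
Qed.

Lemma homog_in_span d r (f : 'I_r -> {mpoly k[n]}) :
    (forall m, mdeg m = d -> in_span f 'X_[m]) ->
  forall p, p \is d.-homog -> in_span f p.
Proof.
move=> fX p /dhomogP pd; rewrite [p]mpolyE big_seq; apply: in_span_sum => m mp.
exact/in_span_scale/fX/pd.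
Qed.

End ModuloIdeal.

(** * Growth of Hilbert functions *)

Lemma mdegS_decomp n (m : 'X_{1..n}) d : mdeg m = d.+1 ->
  exists i m', m = (U_(i) + m')%MM /\ mdeg m' = d.
Proof.
move=> dm; have /existsP[i mi] : [exists i, m i != 0].
  apply: contra_eqT dm => /existsPn m0.
  by rewrite mdegE big1 // => i _; apply/eqP; rewrite -[_ == _]negbK m0.
have mE : m = (U_(i) + (m - U_(i)))%MM.
  apply/mnmP => l; rewrite mnmDE mnmBE mnm1E.
  by case: eqP => [<-|_]; rewrite ?subn0 // subnKC // lt0n.
exists i, (m - U_(i))%MM; split => //.
by move: dm; rewrite {1}mE mdegD mdeg1 => -[].
Qed.

Section HilbertFunction.
Local Open Scope ring_scope.
Variables (k : fieldType) (n : nat) (I : {pred {mpoly k[n]}}) (h : nat -> nat).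
Hypotheses (homI : homogeneous_ideal I) (hI : hilbert_function I h).

Let idI : idealr_closed I := proj1 homI.

Lemma hilbert_le_spanning d r (f : 'I_r -> {mpoly k[n]}) :
  (forall m, mdeg m = d -> in_span I f 'X_[m]) -> (h d <= r)%N.
Proof.
move=> fX; apply: (quot_dim_le_spanning idI (hI d)) => p.
exact: homog_in_span idI _ _ _ fX _.
Qed.

Lemma hilbert_eq0P d : h d = 0 <-> forall p, p \is d.-homog -> p \in I.
Proof.
split=> [h0 p pd|dI].
  have [b [_ _ /(_ p pd)[c]]] := hI d.
  by rewrite big1 ?subr0 // => i; have := ltn_ord i; rewrite [X in (_ < X)%N]h0.
apply/eqP; rewrite -leqn0; apply: (@hilbert_le_spanning d 0 (fun=> 0)) => m dm.
by apply: in_span_ideal; apply: dI; rewrite dhomogX /= dm.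
Qed.

Lemma hilbert0 : h 0 = 1.
Proof.
apply/eqP; rewrite eqn_leq; apply/andP; split.
  apply: (@hilbert_le_spanning 0 1 (fun=> 1)) => m /eqP.
  rewrite mdeg_eq0 => /eqP->; rewrite mpolyX0.
  exact: (in_span_mem idI (fun _ : 'I_1 => 1) 0).
rewrite lt0n; apply/eqP => /hilbert_eq0P H.
by have := ideal_1 idI; rewrite H // dhomog1.
Qed.

Lemma hilbert_eq0S d : h d = 0 -> h d.+1 = 0.
Proof.
move=> /hilbert_eq0P H.
apply/eqP; rewrite -leqn0; apply: (@hilbert_le_spanning _ 0 (fun=> 0)) => m.
move=> /mdegS_decomp[i [m' [-> dm']]]; apply: in_span_ideal.
by rewrite mpolyXD; apply/(ideal_mul idI)/H; rewrite dhomogX /= dm'.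
Qed.

(** A one-dimensional graded piece of degree [d > 0] is spanned by a monomial
    [x_i * m1].  As [x_l * m1] also has degree [d], it is a multiple of [x_i * m1], so
    [x_l * (x_i * m1) = x_i * (x_l * m1)] is a multiple of [x_i * (x_i * m1)]. *)
Lemma hilbert_le1S d : (0 < d)%N -> (h d <= 1)%N -> (h d.+1 <= 1)%N.
Proof.
case: d => // d _; rewrite leq_eqVlt ltnS leqn0 => /orP[/eqP h1|/eqP/hilbert_eq0S->//].
have /existsP : [exists m : 'X_{1..n < d.+2}, (mdeg m == d.+1) && ('X_[m] \notin I)].
  apply: contra_eqT h1 => /existsPn H; rewrite neq_ltn ltnS; apply/orP; left.
  apply: (@hilbert_le_spanning _ 0 (fun=> 0)) => m dm; apply: in_span_ideal.
  have dm' : (mdeg m < d.+2)%N by rewrite dm.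
  by have := H (BMultinom dm'); rewrite /= dm eqxx /= negbK.
move=> [[m /= _]] /andP[/eqP dm mI].
have span_m m' : mdeg m' = d.+1 -> in_span I (fun _ : 'I_1 => 'X_[m]) 'X_[m'].
  move=> dm'; have := hI d.+1; rewrite h1 => /(quot_dim1_span idI)/(_ _ mI).
  by apply; rewrite inE dhomogX /= ?dm ?dm'.
have [i [m1 [mE dm1]]] := mdegS_decomp dm.
apply: (@hilbert_le_spanning _ 1 (fun=> 'X_[U_(i) + m])) => m2.
move=> /mdegS_decomp[l [m3 [-> /span_m m3P]]].
rewrite [X in in_span _ _ X]mpolyXD; apply: (in_span_trans idI (in_span_mul idI 'X_l m3P)) => _.
rewrite mE -mpolyXD [in X in in_span _ _ X]Monoid.mulmCA.
have : mdeg (U_(l) + m1)%MM = d.+1 by rewrite mdegD mdeg1 dm1.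
move=> /span_m /(in_span_mul idI 'X_i).
by rewrite /= -!mpolyXD mE.
Qed.

(** The quotient is generated by two linear forms [u], [v], so the products
    [u ^ i * v ^ (d - i)] span its degree [d]. *)
Lemma hilbert_two_generators d : (h 1 <= 2)%N -> (h d <= d.+1)%N.
Proof.
move=> h1; have [b [_ _ bS]] := hI 1.
(* A basis of degree one, padded with zeros to two elements. *)
pose g (i : 'I_2) := if insub (val i) is Some l then b l else 0.
have gX i : in_span I g 'X_i.
  apply: (in_span_trans idI (bS _ _)); first by rewrite inE dhomogX /= mdeg1.
  move=> l; suff -> : b l = g (widen_ord h1 l) by exact: in_span_mem.
  by rewrite /g /= valK.
pose F e (i : 'I_e.+1) := g 0 ^+ i * g 1 ^+ (e - i).
have FS e p : in_span I (@F e) p -> forall l, in_span I (@F e.+1) ('X_l * p).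
  move=> pF l; rewrite mulrC.
  apply: (in_span_trans idI (in_span_mul idI p (gX l))) => i; rewrite mulrC.
  apply: (in_span_trans idI (in_span_mul idI (g i) pF)) => {pF p l} l.
  have [->|->] : i = 0 \/ i = 1.
  - by case: i => -[|[|//]] ?; [left|right]; apply/val_inj.
  - suff -> : g 0 * F e l = @F e.+1 (lift ord0 l) by exact: in_span_mem.
    by rewrite /F /= /bump /= add1n subSS mulrA -exprS.
  - suff -> : g 1 * F e l = @F e.+1 (widen_ord (leqnSn _) l) by exact: in_span_mem.
    by rewrite /F /= mulrCA -exprS subSn // -ltnS.
apply: (@hilbert_le_spanning d _ (@F d)).
elim: d => [|d IHd] m; last first.
  by move=> /mdegS_decomp[i [m' [-> dm']]]; rewrite mpolyXD; apply/FS/IHd.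
move=> /eqP; rewrite mdeg_eq0 => /eqP->; rewrite mpolyX0.
by have := in_span_mem idI (@F 0) 0; rewrite {2}/F /= subnn !expr0 mulr1.
Qed.

End HilbertFunction.

(** * Symmetry of Gorenstein Hilbert functions *)

Section GorensteinSymmetry.
Local Open Scope ring_scope.
Variables (k : fieldType) (n : nat) (I : {pred {mpoly k[n]}}) (h : nat -> nat) (j : nat).
Hypotheses (agI : AG_ideal I) (hI : hilbert_function I h).
Hypotheses (hj : h j != 0%N) (hS : h j.+1 = 0).

Let homI : homogeneous_ideal I. Proof. by case: agI. Qed.
Let idI : idealr_closed I := proj1 homI.

(** The forms of top degree lie in the socle, which is one-dimensional. *)
Lemma socle_spanned_by_top :
  exists2 t, t \is j.-homog & forall p, p \in socle I -> in_span I (fun _ : 'I_1 => t) p.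
Proof.
have [b [bd bI _]] := hI j; move: hj; rewrite -lt0n => hj0.
pose i0 := Ordinal hj0; exists (b i0); first exact: bd.
have [_ _ soc1] := agI; apply: (quot_dim1_span idI soc1).
  apply/forallP => i; move/(hilbert_eq0P homI hI): hS; apply.
  by rewrite -add1n; apply: dhomogM; [rewrite dhomogX /= mdeg1|apply: bd].
apply/negP => Ib; have /eqP := oner_neq0 k; apply.
have := bI (fun i => (i == i0)%:R) _ i0; apply.
rewrite (bigD1 i0) //= scale1r big1 ?addr0 // => i /negPf->.
by rewrite scale0r.
Qed.

(** A nonzero class of degree below [j] is not in the socle, since the socle is
    spanned in degree [j]; hence some variable does not kill it, and repeating this
    reaches degree [j].  So the multiplication pairing between degrees [d] and [e] is
    nondegenerate. *)
Lemma homog_annihilated d e p : (d + e)%N = j -> p \is d.-homog ->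
  (forall q, q \is e.-homog -> p * q \in I) -> p \in I.
Proof.
have [t tj tS] := socle_spanned_by_top.
elim: e d p => [|e IHe] d p dj pd pI.
  by have := pI 1; rewrite mulr1; apply; apply: dhomog1.
have [|c] := tS p.
  apply/forallP => i; apply: (IHe d.+1); first by rewrite addSnnS.
    by rewrite -add1n; apply: dhomogM => //; rewrite dhomogX /= mdeg1.
  move=> q qe; rewrite -mulrA mulrCA; apply: pI.
  by rewrite -add1n; apply: dhomogM => //; rewrite dhomogX /= mdeg1.
rewrite big_ord1 => /(proj2 homI d).
rewrite pihomogB pihomog_dE // linearZ /= (pihomog_ne0 (d := j) _ tj) ?scaler0 ?subr0 //.
by rewrite -dj -addSnnS neq_ltn ltn_addr ?orbT.
Qed.

(** If [h e < h d], the Gram matrix [C] of the pairing has a kernel vector, which is a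
    form of degree [d] that annihilates degree [e]. *)
Lemma gorenstein_hilbert_le d e : (d + e)%N = j -> (h d <= h e)%N.
Proof.
move=> dj; have [t tj tS] := socle_spanned_by_top.
have [b [bd bI _]] := hI d; have [b' [be _ bS']] := hI e.
have : forall i, exists c : 'I_(h e) -> k, forall l, b i * b' l - c l *: t \in I.
  move=> i; apply: (@fin_all_exists _ _ (fun l c => b i * b' l - c *: t \in I)) => l.
  have [|c] := tS (b i * b' l); last by rewrite big_ord1; exists (c 0).
  apply/forallP => x; move/(hilbert_eq0P homI hI): hS; apply.
  rewrite -dj -add1n; apply: dhomogM; first by rewrite dhomogX /= mdeg1.
  by apply: dhomogM; [apply: bd|apply: be].
move=> /fin_all_exists[C CP]; rewrite leqNgt; apply/negP => lt_ed.
have [w [[i0 /eqP w0] wC]] := tall_kernel C lt_ed; apply/w0/bI.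
have wd : \sum_i w i *: b i \is d.-homog.
  by apply: rpred_sum => i _; apply: rpredZ; apply: bd.
apply: (homog_annihilated dj wd) => q /bS'[c Ic].
rewrite -(subrK (\sum_l c l *: b' l) q) mulrDr.
apply: ideal_add; [exact: idI|exact: ideal_mul|].
rewrite mulr_sumr; apply: ideal_sum => // l _.
rewrite -scalerAr; apply: ideal_scale => //; rewrite mulr_suml.
have -> : \sum_i w i *: b i * b' l = \sum_i w i *: (b i * b' l - C i l *: t).
  under [RHS]eq_bigr do rewrite scalerBr scalerA.
  rewrite sumrB -scaler_suml wC scale0r subr0.
  by apply: eq_bigr => i _; rewrite scalerAl.
by apply: ideal_sum => // i _; apply: ideal_scale.
Qed.

Lemma gorenstein_hilbert_sym d : (d <= j)%N -> h d = h (j - d)%N.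
Proof.
by move=> dj; apply/eqP; rewrite eqn_leq !gorenstein_hilbert_le ?subnK ?subnKC.
Qed.

End GorensteinSymmetry.

(** * Quotients with a basis of monomial classes *)

Section LabelIdeal.
Local Open Scope ring_scope.
Variables (k : fieldType) (n : nat) (L : eqType) (lam : 'X_{1..n} -> option L).
Implicit Types (p q : {mpoly k[n]}) (m : 'X_{1..n}) (l : L).

Definition label_sum l p : k := \sum_(m <- msupp p | lam m == Some l) p@_m.

(** The kernel of the linear map that sends a monomial to its label, and to zero if it
    has none.  It is an ideal once the labelling is compatible with multiplication. *)
Definition label_ideal : {pred {mpoly k[n]}} :=
  [pred p | all (fun m => if lam m is Some l then label_sum l p == 0 else true) (msupp p)].

(** A common index set for several supports; this makes [label_sum] linear. *)
Lemma label_sum_widen l p (s : seq 'X_{1..n}) : uniq s -> {subset msupp p <= s} ->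
  label_sum l p = \sum_(m <- s | lam m == Some l) p@_m.
Proof.
move=> s_uniq ps; rewrite [RHS](bigID (mem (msupp p))) /= [X in _ + X]big1 ?addr0; last first.
  by move=> m /andP[_ /memN_msupp_eq0].
under eq_bigl do rewrite andbC.
rewrite -big_filter_cond; apply: perm_big; apply: uniq_perm; rewrite ?filter_uniq ?msupp_uniq //.
by move=> m; rewrite mem_filter; case: (boolP (m \in msupp p)) => //= /ps->.
Qed.

Lemma label_sumD l p q : label_sum l (p + q) = label_sum l p + label_sum l q.
Proof.
pose s := undup (msupp p ++ msupp q).
have widen r : {subset msupp r <= msupp p ++ msupp q} ->
    label_sum l r = \sum_(m <- s | lam m == Some l) r@_m.
  by move=> rs; apply: label_sum_widen; [apply: undup_uniq|move=> m /rs; rewrite mem_undup].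
rewrite !widen -?big_split /=; first by apply: eq_bigr => m _; rewrite mcoeffD.
- by move=> m mq; rewrite mem_cat mq orbT.
- by move=> m mp; rewrite mem_cat mp.
- exact: msuppD_le.
Qed.

Lemma label_sumZ l c p : label_sum l (c *: p) = c * label_sum l p.
Proof.
rewrite (@label_sum_widen _ _ _ (msupp_uniq p)) ?mulr_sumr; last exact: msuppZ_le.
by apply: eq_bigr => m _; rewrite mcoeffZ.
Qed.

Lemma label_sum0 l : label_sum l 0 = 0.
Proof. by rewrite /label_sum msupp0 big_nil. Qed.

Lemma label_sumX l m : label_sum l 'X_[m] = (lam m == Some l)%:R.
Proof. by rewrite /label_sum msuppX big_mkcond big_seq1 mcoeffX eqxx; case: ifP. Qed.

Lemma label_sum_sumX l (X : Type) (s : seq X) (Q : pred X) (c : X -> k) f :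
  label_sum l (\sum_(x <- s | Q x) c x *: 'X_[f x]) =
  \sum_(x <- s | Q x && (lam (f x) == Some l)) c x.
Proof.
rewrite (big_morph _ (label_sumD l) (label_sum0 l)) big_mkcondr; apply: eq_bigr => x _.
by rewrite label_sumZ label_sumX; case: ifP; rewrite ?mulr1 ?mulr0.
Qed.

Lemma label_idealP p : reflect (forall l, label_sum l p = 0) (p \in label_ideal).
Proof.
apply: (iffP allP) => [H l|H m _]; last by case: (lam m) => // l; rewrite H.
have [/hasP[m mp /eqP lm]|/hasPn N] := boolP (has (fun m => lam m == Some l) (msupp p)).
  by have := H m mp; rewrite lm => /eqP.
by rewrite /label_sum big_seq_cond big1 // => m /andP[/N/negPf->].
Qed.

(** One monomial for each label gives a basis, with [label_sum] as coordinates. *)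
Lemma label_quot_dim (V : {pred {mpoly k[n]}}) (s : seq L) : uniq s ->
    (forall l, l \in s -> exists2 m, 'X_[m] \in V & lam m = Some l) ->
    (forall p m l, p \in V -> m \in msupp p -> lam m = Some l -> l \in s) ->
  quot_dim V label_ideal (size s).
Proof.
move=> us sV Vs.
have /fin_all_exists2[r rV lr] : forall i : 'I_(size s),
    exists2 m, 'X_[m] \in V & lam m = Some (tnth (in_tuple s) i).
  by move=> i; apply: sV; apply: mem_tnth.
have t_inj : injective (tnth (in_tuple s)) by apply/tuple_uniqP.
have lin c i : label_sum (tnth (in_tuple s) i) (\sum_l c l *: 'X_[r l]) = c i.
  rewrite label_sum_sumX (big_pred1 i) // => l.
  by rewrite lr (inj_eq (@Some_inj _)) (inj_eq t_inj).
exists (fun i => 'X_[r i]); split=> // [c /label_idealP cI i|p pV].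
  by rewrite -(lin c i).
exists (fun i => label_sum (tnth (in_tuple s) i) p).
apply/label_idealP => l; rewrite -scaleN1r label_sumD label_sumZ mulN1r.
have [/(tnthP (in_tuple s))[i ->]|ls] := boolP (l \in s); first by rewrite lin subrr.
rewrite label_sum_sumX big1 ?subr0 => [|i]; last first.
  by rewrite lr => /eqP[El]; rewrite -El mem_tnth in ls.
rewrite /label_sum big_seq_cond big1 // => m /andP[mp /eqP lm].
by rewrite (Vs p m l) in ls.
Qed.

Hypothesis lam0 : lam 0%MM != None.
Hypothesis lam_congr : forall m m' e, lam m = lam m' -> lam (m + e)%MM = lam (m' + e)%MM.
Hypothesis lam_none : forall m e, lam m = None -> lam (m + e)%MM = None.
Hypothesis lam_deg : forall m m', lam m = lam m' -> lam m != None -> mdeg m = mdeg m'.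

Lemma label_sum_shift l e p :
  label_sum l ('X_[e] * p) = \sum_(m <- msupp p | lam (m + e)%MM == Some l) p@_m.
Proof.
rewrite {1}[p]mpolyE mulr_sumr.
under eq_bigr do rewrite -scalerAr -mpolyXD addmC.
exact: label_sum_sumX.
Qed.

(** The monomials [m] with [lam (m + e) = Some l] form a union of label classes. *)
Lemma label_ideal_mulX e p : p \in label_ideal -> 'X_[e] * p \in label_ideal.
Proof.
move=> /label_idealP pI; apply/label_idealP => l; rewrite label_sum_shift big_mkcond.
pose ls := undup (map lam (msupp p)).
pose F m := if lam (m + e)%MM == Some l then p@_m else 0.
have -> : \sum_(m <- msupp p) F m = \sum_(x <- ls) \sum_(m <- msupp p | lam m == x) F m.
  rewrite (exchange_big_dep predT) //= big_seq [RHS]big_seq; apply: eq_bigr => m mp.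
  have lm : lam m \in ls by rewrite mem_undup map_f.
  rewrite -big_filter (perm_big [:: lam m]) ?big_seq1 //.
  apply: uniq_perm; rewrite ?filter_uniq ?undup_uniq // => x.
  by rewrite mem_filter inE eq_sym; case: eqP => // ->.
rewrite big_seq big1 // => x; rewrite mem_undup => /mapP[m0 _ ->].
case l0: (lam m0) => [l'|]; last first.
  by rewrite big1 // => m /eqP lm; rewrite /F lam_none.
have [E|/eqP NE] := boolP (lam (m0 + e)%MM == Some l).
  rewrite -[RHS](pI l'); apply: eq_bigr => m /eqP lm.
  by rewrite /F (@lam_congr m m0) ?l0 // E.
rewrite big1 // => m /eqP lm; rewrite /F (@lam_congr m m0) ?l0 //.
by case: eqP.
Qed.

Lemma label_ideal_closed : idealr_closed label_ideal.
Proof.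
have I0 : 0 \in label_ideal by apply/label_idealP => l; apply: label_sum0.
have ID p q : p \in label_ideal -> q \in label_ideal -> p + q \in label_ideal.
  move=> /label_idealP pI /label_idealP qI; apply/label_idealP => l.
  by rewrite label_sumD pI qI addr0.
split=> // [|u p q pI qI].
  case l0: (lam 0%MM) lam0 => [l|] // _; apply/label_idealP => /(_ l)/eqP.
  by rewrite -mpolyX0 label_sumX l0 eqxx oner_eq0.
apply: (ID _ _ _ qI); rewrite [u]mpolyE mulr_suml.
apply: (big_ind (fun x => x \in label_ideal)) => [||m _].
- exact: I0.
- exact: ID.
rewrite -scalerAl; apply/label_idealP => l; rewrite label_sumZ.
by have /label_idealP-> := label_ideal_mulX m pI; rewrite mulr0.
Qed.

Lemma label_ideal_homogeneous : homogeneous_ideal label_ideal.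
Proof.
split=> [|d p /label_idealP pI]; first exact: label_ideal_closed.
apply/label_idealP => l; rewrite pihomogE label_sum_sumX.
have [/existsP|] :=
  boolP [exists m : 'X_{1..n < (msize p).+1}, (mdeg m == d) && (lam m == Some l)].
  case=> m0 /andP[/eqP d0 /eqP l0]; rewrite -[RHS](pI l); apply: eq_bigl => m.
  apply: andb_idl => /eqP lm; rewrite -d0; apply/eqP; apply: lam_deg; by rewrite lm.
move=> /existsPn N; rewrite big_seq_cond big1 // => m /andP[mp].
have mb : (mdeg m < (msize p).+1)%N by apply/ltnW/msize_mdeg_lt.
by have := N (BMultinom mb) => /= /negPf->.
Qed.

Lemma label_hilbert_function (s : nat -> seq L) :
    (forall d, uniq (s d)) ->
    (forall d l, l \in s d <-> exists2 m, mdeg m = d & lam m = Some l) ->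
  hilbert_function label_ideal (fun d => size (s d)).
Proof.
move=> us sP d; apply: label_quot_dim => // [l /sP[m dm lm]|p m l].
  by exists m; rewrite // inE dhomogX /= dm.
by rewrite inE => /dhomogP pd mp lm; apply/sP; exists m => //; apply: pd.
Qed.

End LabelIdeal.

(** * Annihilators of forms under contraction *)

Lemma notnilp_ex (X : eqType) (l : seq X) : ~~ nilp l -> exists t, t \in l.
Proof. by case: l => // t l _; exists t; rewrite mem_head. Qed.

Section Contraction.
Variables (n : nat) (S : seq 'X_{1..n}) (j : nat).
Implicit Types (m e s t : 'X_{1..n}).

(** The result of letting [x^m] act by contraction on the sum [F] of the dual monomials
    in [S].  Contraction, unlike differentiation, behaves in the same way in every
    characteristic. *)
Definition contract m : seq 'X_{1..n} := [seq (s - m)%MM | s <- S & (m <= s)%MM].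

(** When distinct contractions have disjoint supports, the nonzero ones are linearly
    independent; a polynomial then annihilates [F] exactly when its coefficients sum to
    zero over each set of monomials with the same nonzero contraction, that is, when it
    lies in the label ideal of this labelling. *)
Definition contract_label m : option (seq 'X_{1..n}) :=
  if nilp (contract m) then None else Some (contract m).

Lemma contractD m e :
  contract (m + e)%MM = [seq (t - e)%MM | t <- contract m & (e <= t)%MM].
Proof.
rewrite /contract filter_map -map_comp -filter_predI.
rewrite (@eq_filter _ _ (predI (preim (fun s => (s - m)%MM) (fun t => e <= t)%MM) (fun s => m <= s)%MM)).
  by apply: eq_map => s; rewrite /= submDA.
move=> s /=; apply/mnm_lepP/andP => [H|[/mnm_lepP H1 /mnm_lepP H2] i].
  split; apply/mnm_lepP => i; have := H i; rewrite !mnmE; lia.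
by have := H1 i; have := H2 i; rewrite !mnmE; lia.
Qed.

Lemma mem_contract m t : (t \in contract m) = ((t + m)%MM \in S).
Proof.
apply/mapP/idP => [[s]|tS].
  by rewrite mem_filter => /andP[ms sS] ->; rewrite submK.
by exists (t + m)%MM; rewrite ?mem_filter ?tS ?lem_addl ?addmK.
Qed.

Lemma contract_labelP m l : contract_label m = Some l <-> contract m = l /\ ~~ nilp l.
Proof.
rewrite /contract_label; case: ifP => [E|/negbT E]; split => //.
- by case=> El; rewrite -El E.
- by case=> <-.
- by case=> ->.
Qed.

Hypothesis S_neq0 : S != [::].
Hypothesis S_deg : forall s, s \in S -> mdeg s = j.
Hypothesis S_disj : forall m m' t,
  t \in contract m -> t \in contract m' -> contract m = contract m'.

Lemma contract_deg m t : t \in contract m -> (mdeg m + mdeg t)%N = j.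
Proof. by rewrite mem_contract => /S_deg; rewrite mdegD addnC. Qed.

Variable k : fieldType.
Local Open Scope ring_scope.

Let I : {pred {mpoly k[n]}} := label_ideal contract_label.

Let lam0 : contract_label 0%MM != None.
Proof.
rewrite /contract_label; case: ifP => // /nilP E.
case: S S_neq0 E mem_contract => // s S' _ E /(_ 0%MM s).
by rewrite E addm0 in_nil mem_head.
Qed.

Let lam_congr m m' e : contract_label m = contract_label m' ->
  contract_label (m + e)%MM = contract_label (m' + e)%MM.
Proof.
rewrite /contract_label !contractD.
by case: ifP => [/nilP->|_]; case: ifP => [/nilP->|_] // [->].
Qed.

Let lam_none m e : contract_label m = None -> contract_label (m + e)%MM = None.
Proof. by rewrite /contract_label !contractD; case: ifP => // /nilP->. Qed.

Let lam_deg m m' : contract_label m = contract_label m' -> contract_label m != None ->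
  mdeg m = mdeg m'.
Proof.
case l: (contract_label m) => [l'|] // /esym.
move: l => /contract_labelP[lm /notnilp_ex[t tl]] /contract_labelP[lm' _] _.
have : t \in contract m' by rewrite lm'.
have : t \in contract m by rewrite lm.
by move=> /contract_deg E /contract_deg E'; apply: (@addIn (mdeg t)); rewrite E E'.
Qed.

Lemma contraction_homogeneous : homogeneous_ideal I.
Proof. exact: label_ideal_homogeneous. Qed.

Lemma contraction_hilbert (s : nat -> seq (seq 'X_{1..n})) :
    (forall d, uniq (s d)) ->
    (forall d l, l \in s d <-> [/\ exists2 m, mdeg m = d & contract m = l & ~~ nilp l]) ->
  hilbert_function I (fun d => size (s d)).
Proof.
move=> us sP; apply: label_hilbert_function => // d l.
split=> [/sP[[m dm ml] l0]|[m dm /contract_labelP[ml l0]]].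
  by exists m => //; apply/contract_labelP.
by apply/sP; split => //; exists m.
Qed.

Lemma contraction_artinian : artinian_quotient I.
Proof.
pose B := [seq contract m | m : 'X_{1..n < j.+1}].
exists (size (undup [seq l <- B | ~~ nilp l])); apply: label_quot_dim => [|l|p m l _ _].
- exact: undup_uniq.
- rewrite mem_undup mem_filter => /andP[l0 /imageP[m _ lm]].
  by exists m => //; apply/contract_labelP.
move=> /contract_labelP[lm l0]; rewrite mem_undup mem_filter l0.
have [t tm] := notnilp_ex l0; rewrite -lm in tm.
have mj : (mdeg m < j.+1)%N by rewrite ltnS -(contract_deg tm) leq_addr.
by apply/imageP; exists (BMultinom mj).
Qed.

(** The class of any [s0] in [S] spans the socle.  If [t] is a dual monomial of a label
    [l] other than the top one, then multiplication by [x^t] carries [l], and by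
    disjointness no other label, to the top label; so a socle element has coordinate
    zero at [l]. *)
Lemma contraction_socle : quot_dim (socle I) I 1.
Proof.
have [s0 sS] : exists s, s \in S by case: S S_neq0 => // s ? _; exists s; rewrite mem_head.
have s0_0 : 0%MM \in contract s0 by rewrite mem_contract add0m.
pose l0 := contract s0.
have lab0 : contract_label s0 = Some l0.
  by apply/contract_labelP; split => //; apply: contraTN s0_0 => /nilP; rewrite /l0 => ->.
have lab_top m : (contract_label m == Some l0) = (m \in S).
  apply/eqP/idP => [/contract_labelP[E _]|mS].
    by rewrite -[m]add0m -mem_contract E.
  by apply/contract_labelP; split; [apply: (@S_disj _ _ 0%MM); rewrite // mem_contract add0m
     |apply: contraTN s0_0 => /nilP; rewrite /l0 => ->].
exists (fun=> 'X_[s0]); split=> [_|c|p /forallP pX].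
- apply/forallP => i; rewrite -mpolyXD; apply/label_idealP => l; rewrite label_sumX.
  case: eqP => // /contract_labelP[El /notnilp_ex[t]]; rewrite -El => /contract_deg.
  by rewrite mdegD mdeg1 (S_deg sS); lia.
- rewrite big_ord1 => /label_idealP/(_ l0); rewrite label_sumZ label_sumX lab0 eqxx mulr1.
  by move=> c0 i; rewrite ord1.
exists (fun=> label_sum contract_label l0 p); rewrite big_ord1.
apply/label_idealP => l; rewrite -scaleN1r label_sumD !label_sumZ label_sumX lab0.
have [[<-]|ll0] := eqVneq; first by rewrite mulr1 mulN1r subrr.
rewrite !mulr0 addr0.
have [/hasP[m0 _ /eqP lm0]|/hasPn N] :=
  boolP (has (fun m => contract_label m == Some l) (msupp p)); last by rewrite /label_sum big_seq_cond big1 // => m /andP[/N/negPf->].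
have [ml /notnilp_ex[t tl]] := (contract_labelP m0 l).1 lm0.
have dt : mdeg t != 0.
  apply: contra ll0; rewrite mdeg_eq0 => /eqP t0; rewrite -lm0 eq_sym lab_top.
  by rewrite -[m0]add0m -mem_contract ml -t0.
have : 'X_[t] * p \in I.
  case Et: (mdeg t) dt => [|d] // _; have [i [t' [-> _]]] := mdegS_decomp Et.
  rewrite addmC mpolyXD -mulrA; apply: ideal_mul; last exact: pX.
  by case: contraction_homogeneous.
move=> /label_idealP/(_ l0); rewrite label_sum_shift => <-; apply: eq_bigl => m.
rewrite lab_top addmC -mem_contract.
apply/eqP/idP => [/contract_labelP[-> _] //|tm].
by rewrite -lm0 /contract_label (S_disj tm (m' := m0)) // ml.
Qed.

Lemma contraction_AG : AG_ideal I.
Proof.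
by split; [apply: contraction_homogeneous|apply: contraction_artinian|apply: contraction_socle].
Qed.

End Contraction.

(** * Forms in three variables *)

Section TernaryForms.

(* Triples of numbers, on which contractions can be computed by evaluation. *)
Local Notation exponent := (nat * nat * nat)%type.
Implicit Types (s t : exponent) (F : seq exponent).

Definition exponent_deg t : nat := t.1.1 + t.1.2 + t.2.
Definition exponent_le s t : bool := [&& s.1.1 <= t.1.1, s.1.2 <= t.1.2 & s.2 <= t.2].
Definition exponent_sub s t : exponent := (s.1.1 - t.1.1, s.1.2 - t.1.2, s.2 - t.2).
Definition exponents (d : nat) : seq exponent :=
  [seq (a, b, d - a - b) | a <- iota 0 d.+1, b <- iota 0 (d - a).+1].
Definition derivative F t : seq exponent := [seq exponent_sub s t | s <- F & exponent_le t s].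
Definition derivatives F (d : nat) : seq (seq exponent) :=
  undup [seq r <- [seq derivative F t | t <- exponents d] | ~~ nilp r].

(** The orders of derivation stop at the degree of [F], beyond which all derivatives
    vanish. *)
Definition separated_form (j : nat) F : bool :=
  let R := flatten [seq derivatives F d | d <- iota 0 j.+1] in
  [&& ~~ nilp F, all (fun s => exponent_deg s == j) F
    & all (fun r : seq exponent => all (fun r' : seq exponent => (r == r') || ~~ has (mem r') r) R) R].

Definition form_hilbert (j : nat) F : seq nat := [seq size (derivatives F d) | d <- iota 0 j.+1].

Definition monomial t : 'X_{1..3} := [multinom nth 0 [:: t.1.1; t.1.2; t.2] i | i < 3].

Lemma mnm3P (m m' : 'X_{1..3}) :
  m (@Ordinal 3 0 isT) = m' (@Ordinal 3 0 isT) -> m (@Ordinal 3 1 isT) = m' (@Ordinal 3 1 isT) ->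
  m (@Ordinal 3 2 isT) = m' (@Ordinal 3 2 isT) -> m = m'.
Proof.
move=> E0 E1 E2; apply/mnmP => -[[|[|[|//]]] i3].
- by rewrite (_ : Ordinal i3 = @Ordinal 3 0 isT) //; apply: val_inj.
- by rewrite (_ : Ordinal i3 = @Ordinal 3 1 isT) //; apply: val_inj.
- by rewrite (_ : Ordinal i3 = @Ordinal 3 2 isT) //; apply: val_inj.
Qed.

Lemma monomial_inj : injective monomial.
Proof.
move=> [[a b] c] [[a' b'] c'] /mnmP E.
have := E (@Ordinal 3 0 isT); have := E (@Ordinal 3 1 isT); have := E (@Ordinal 3 2 isT).
by rewrite !mnmE /= => -> -> ->.
Qed.

Lemma monomial_surj m : exists t, m = monomial t.
Proof.
exists (m (@Ordinal 3 0 isT), m (@Ordinal 3 1 isT), m (@Ordinal 3 2 isT)).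
by apply: mnm3P; rewrite mnmE.
Qed.

Lemma mdeg_monomial t : mdeg (monomial t) = exponent_deg t.
Proof. by rewrite mdegE !big_ord_recl big_ord0 !mnmE /= addn0 addnA. Qed.

Lemma monomial_le s t : (monomial s <= monomial t)%MM = exponent_le s t.
Proof.
apply/mnm_lepP/and3P => [H|[H0 H1 H2] [[|[|[|//]]] i3]]; rewrite ?mnmE //=.
have := H (@Ordinal 3 0 isT); have := H (@Ordinal 3 1 isT); have := H (@Ordinal 3 2 isT).
by rewrite !mnmE /= => -> -> ->.
Qed.

Lemma monomial_sub s t : (monomial s - monomial t)%MM = monomial (exponent_sub s t).
Proof. by apply: mnm3P; rewrite !mnmE. Qed.

Lemma contract_monomial F t :
  contract (map monomial F) (monomial t) = map monomial (derivative F t).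
Proof.
rewrite /contract /derivative filter_map -!map_comp.
rewrite (@eq_filter _ _ (exponent_le t)) => [|s]; last exact: monomial_le.
by apply: eq_map => s /=; apply: monomial_sub.
Qed.

Lemma mem_exponents d t : (t \in exponents d) = (exponent_deg t == d).
Proof.
apply/allpairsPdep/eqP => [[a [b [+ + ->]]]|<-].
  by rewrite !mem_iota /exponent_deg /=; lia.
exists t.1.1, t.1.2; rewrite !mem_iota /exponent_deg; split; try lia.
by case: t => -[a b] c /=; congr (_, _, _); lia.
Qed.

Lemma mem_derivatives F d r :
  r \in derivatives F d <-> (exists2 t, exponent_deg t = d & derivative F t = r) /\ ~~ nilp r.
Proof.
rewrite mem_undup mem_filter; split=> [/andP[-> /mapP[t]]|[[t dt <-] ->]].
  by rewrite mem_exponents => /eqP dt ->; split=> //; exists t.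
by rewrite map_f // mem_exponents dt.
Qed.

Lemma gorenstein_of_form (k : fieldType) j F (H : seq nat) :
  separated_form j F -> H = form_hilbert j F -> nth 0 H j != 0 -> gorenstein_sequence k j H.
Proof.
move=> /and3P[F0 /allP Fj sepF] HE Hj; split=> //; first by rewrite HE size_map size_iota.
have deg_der t s : s \in derivative F t -> exponent_deg t <= j.
  case/mapP => r; rewrite mem_filter => /andP[/and3P[? ? ?] /Fj/eqP <-] _.
  by rewrite /exponent_deg; lia.
pose S := map monomial F.
have S0 : S != [::] by rewrite -size_eq0 size_map.
have Sj (u : 'X_{1..3}) : u \in S -> mdeg u = j.
  by case/mapP => t /Fj/eqP <- ->; rewrite mdeg_monomial.
have Sdisj m m' (u : 'X_{1..3}) : u \in contract S m -> u \in contract S m' -> contract S m = contract S m'.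
  have [x ->] := monomial_surj m; have [v ->] := monomial_surj m'.
  have [w ->] := monomial_surj u.
  rewrite !contract_monomial !(mem_map monomial_inj) => wx wv; congr map.
  have inR z : w \in derivative F z ->
      derivative F z \in flatten [seq derivatives F d | d <- iota 0 j.+1].
    move=> wz; apply/flatten_mapP; exists (exponent_deg z).
      by rewrite mem_iota ltnS (deg_der _ _ wz).
    by apply/mem_derivatives; split; [exists z|case: (derivative F z) wz].
  move/allP: sepF => /(_ _ (inR _ wx))/allP/(_ _ (inR _ wv))/orP[/eqP //|/hasPn/(_ _ wx)].
  by rewrite /= wv.
exists (label_ideal (contract_label S)); split; first exact: (contraction_AG S0 Sj Sdisj k). 
pose s d := map (map monomial) (derivatives F d).
have HS d : nth 0 H d = size (s d).
  rewrite HE size_map; have [dj|dj] := leqP d j.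
    by rewrite (nth_map 0) ?size_iota // nth_iota.
  rewrite nth_default ?size_map ?size_iota //; case E: derivatives => [|r R] //.
  have /mem_derivatives[[t dt rE] r0] : r \in derivatives F d by rewrite E mem_head.
  have [u] := notnilp_ex r0; rewrite -rE => /deg_der.
  by rewrite dt leqNgt dj.
move=> d; rewrite HS; apply: (@contraction_hilbert _ S k s) => {}d.
  rewrite map_inj_uniq ?undup_uniq //; exact/inj_map/monomial_inj.
move=> l; split=> [/mapP[r /mem_derivatives[[t dt <-] r0] ->]|[[m]]].
  split; last by rewrite /nilp size_map.
  by exists (monomial t); rewrite ?mdeg_monomial ?contract_monomial.
have [t ->] := monomial_surj m; rewrite mdeg_monomial contract_monomial => dt <-.
rewrite /nilp size_map => r0; rewrite (mem_map (inj_map monomial_inj)).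
by apply/mem_derivatives; split=> //; exists t.
Qed.

End TernaryForms.

(** * Order ideals in two variables *)

Section PlaneOrderIdeal.
Variables (k : fieldType) (D : seq nat).
Hypothesis D0 : nth 0 D 0 = 1.
Hypothesis D_le : forall d, nth 0 D d <= d.+1.
Hypothesis D_step : forall d, minn (nth 0 D d.+1) d.+1 <= nth 0 D d.

(* In degree d, keep the monomials X^(d - b) Y^b with b < D_d.  The hypothesis D_step
   says that this set of monomials is closed under division. *)
Let X : 'I_2 := ord0.
Let Y : 'I_2 := lift ord0 ord0.

Let lam (m : 'X_{1..2}) : option 'X_{1..2} :=
  if m Y < nth 0 D (mdeg m) then Some m else None.

Let mdeg2 (m : 'X_{1..2}) : mdeg m = m X + m Y.
Proof. by rewrite mdegE !big_ord_recl big_ord0 addn0. Qed.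

Let below_step b d e : b <= d -> b < nth 0 D (d + e) -> b < nth 0 D d.
Proof.
elim: e => [|e IHe] bd; first by rewrite addn0.
move=> bD; apply: IHe => //; have := D_step (d + e); rewrite -addnS; lia.
Qed.

Let lamP m m' : lam m = Some m' <-> m' = m /\ m Y < nth 0 D (mdeg m).
Proof. by rewrite /lam; case: ifP => _; split; [case=> ->|case=> ->| |case]. Qed.

Let lam_none m e : lam m = None -> lam (m + e)%MM = None.
Proof.
rewrite /lam; case: ifP => // /negbT; rewrite -leqNgt => mD _.
case: ifP => //; rewrite mdegD mnmDE => meD.
suff: m Y < nth 0 D (mdeg m) by rewrite ltnNge mD.
by apply: (@below_step _ _ (mdeg e)); [rewrite mdeg2 leq_addl|lia].
Qed.

Lemma plane_O_sequence : O_sequence k D.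
Proof.
have lam_congr m m' e : lam m = lam m' -> lam (m + e)%MM = lam (m' + e)%MM.
  case E: (lam m) => [l|] E'; last by rewrite !lam_none.
  by case/lamP: E (esym E') => <- _ /lamP[-> _].
right; exists 2, (label_ideal lam); split.
  apply: label_ideal_homogeneous => //; first by rewrite /lam mdeg0 D0 mnm0E.
  by move=> m m'; case E: (lam m) => [l|] // /esym/lamP[El _] _; case/lamP: E => <-; rewrite El.
pose mon d b : 'X_{1..2} := [multinom if i == X then d - b else b | i < 2].
pose s d := [seq mon d b | b <- iota 0 (nth 0 D d)].
move=> d; have -> : nth 0 D d = size (s d) by rewrite size_map size_iota.
apply: (@label_hilbert_function _ _ _ lam s) => {}d.
  rewrite map_inj_uniq ?iota_uniq // => b b' /mnmP/(_ Y).
  by rewrite !mnmE.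
move=> m; split=> [/mapP[b]|[m' dm /lamP[-> mD]]].
  rewrite mem_iota add0n => /= bD ->; have bd := leq_trans bD (D_le d).
  have md : mdeg (mon d b) = d by rewrite mdeg2 !mnmE /= subnK.
  by exists (mon d b) => //; apply/lamP; rewrite md mnmE.
apply/mapP; exists (m' Y); first by rewrite mem_iota -dm.
apply/mnmP => i; rewrite mnmE -dm mdeg2.
case: i => -[|[|//]] i2.
  by rewrite addnK (_ : Ordinal i2 = X) //; apply: val_inj.
by rewrite (_ : Ordinal i2 = Y) //; apply: val_inj.
Qed.

End PlaneOrderIdeal.

(** * The search for lists of diagonals *)

(** Exponents of the dual monomials in a form whose annihilator has Hilbert function
    [(1, a, b, ..., b, a, 1)], selected by [a = H_1] and [b = H_2].  For [j >= 4] such a form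
    belongs to [b] points of the plane, some of them infinitely near; for [b = 6] these are
    the three coordinate points, each doubled towards the next one. *)
Definition dual_form (j : nat) (H : seq nat) : seq (nat * nat * nat) :=
  match nth 0 H 1, nth 0 H 2 with
  | 2, 3 => [:: (j - 2, 2, 0)]
  | 2, _ => [:: (j - 1, 1, 0)]
  | 3, 6 => [:: (j - 1, 1, 0); (0, j - 1, 1); (1, 0, j - 1)]
  | 3, 5 => [:: (j - 1, 1, 0); (0, j - 1, 1); (0, 0, j)]
  | 3, 4 => [:: (1, 1, j - 2)]
  | 3, _ => [:: (j, 0, 0); (0, j, 0); (0, 0, j)]
  | _, _ => [:: (j, 0, 0)]
  end.

Definition gorenstein_by_form (j : nat) (H : seq nat) : bool :=
  [&& separated_form j (dual_form j H), H == form_hilbert j (dual_form j H) & nth 0 H j != 0].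

Definition plane_growth (D : seq nat) : bool :=
  (nth 0 D 0 == 1) &&
  all (fun d => (nth 0 D d <= d.+1) && (minn (nth 0 D d.+1) d.+1 <= nth 0 D d)) (iota 0 (size D)).

(** Three cases of Macaulay's bound.  The indices may stop at [size D] because [D]
    continues by zeros. *)
Definition O_growth (D : seq nat) : bool :=
  is_zero_seq D ||
  [&& all (fun d => (nth 0 D d == 0) ==> (nth 0 D d.+1 == 0)) (iota 0 (size D)),
      all (fun d => (0 < d) && (nth 0 D d <= 1) ==> (nth 0 D d.+1 <= 1)) (iota 0 (size D))
    & (nth 0 D 1 <= 2) ==> all (fun d => nth 0 D d <= d.+1) (iota 0 (size D))].

Definition shift_diff (N : nat) (P H : seq nat) : seq nat :=
  mkseq (fun u => nth 0 P u - nth 0 (0 :: H) u) N.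

Definition symmetric_plateau (s a b : nat) : seq nat :=
  mkseq (fun u => if (u == 0) || (u == s) then 1 else
                  if (u == 1) || (u == s.-1) then a else b) s.+1.

(** The position [i = N] lies past the last diagonal; its empty list lets the last
    difference be tested like the others. *)
Definition diagonal_candidates (N i : nat) : seq (seq nat) :=
  if i < N then
    undup (nseq (N - i) 0 ::
           [seq symmetric_plateau (N.-1 - i) a b | a <- iota 0 4, b <- iota 0 7])
  else [:: [::]].

(** The conditions that link [H = H(i)] to the two preceding diagonals [P = H(i-1)] and
    [Q = H(i-2)].  The last one is about the difference that starts from [P], since
    [H(i+1)] is not yet known. *)
Definition next_diagonal_ok (N i : nat) (Q P H : seq nat) : bool :=
  [&& (i == 1) ==> ~~ is_zero_seq H,
      all (fun u => [&& nth 0 H u <= nth 0 P u, nth 0 H u <= nth 0 P u.+1 &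
             (1 < i) ==> (nth 0 P u + nth 0 P u.+1 <= nth 0 Q u.+1 + nth 0 H u)])
          (iota 0 (N - i))
    & O_growth (shift_diff (N - i.-1) P H)].

Fixpoint diagonal_lists (T : seq nat) (n : nat) : seq (seq (seq nat)) :=
  if n is n'.+1 then
    flatten [seq [seq rcons ds H | H <- diagonal_candidates (size T) n &
                    next_diagonal_ok (size T) n (nth [::] ds n'.-1) (nth [::] ds n') H]
            | ds <- diagonal_lists T n']
  else [:: [:: T]].

Definition diag_entry (ds : seq (seq nat)) (u v : nat) : nat :=
  if u <= v then nth 0 (nth [::] ds (v - u)) u else 0.

Definition diag_entry_above (ds : seq (seq nat)) (u v : nat) : nat :=
  if u is u'.+1 then diag_entry ds u' v else 0.

Definition diag_string_mult (ds : seq (seq nat)) (u v : nat) : nat :=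
  (diag_entry ds u v + diag_entry_above ds u v.+1)
  - (diag_entry_above ds u v + diag_entry ds u v.+1).

Definition string_table (N : nat) (ds : seq (seq nat)) : seq nat :=
  [seq if u <= v then diag_string_mult ds u v else 0 | u <- iota 0 N, v <- iota 0 N].

Definition well_sized (N : nat) (ds : seq (seq nat)) : bool :=
  [seq size H | H <- ds] == [seq N - i | i <- iota 0 N.+1].

Definition entries_ok (T : seq nat) (ds : seq (seq nat)) : bool :=
  let N := size T in let E := diag_entry ds in
  all (fun u => all (fun v =>
    [&& (u <= v) && (v.+1 < N) ==> (E u v.+1 <= E u v),
        (u < v) ==> (E u v <= E u.+1 v)
      & (u < v) && (v.+1 < N) ==> (E u v + E u.+1 v.+1 <= E u.+1 v + E u v.+1)])
    (iota 0 N)) (iota 0 N).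

Definition plateau_ok (T : seq nat) (ds : seq (seq nat)) : bool :=
  let N := size T in let s := foldr maxn 0 T in
  let top := [seq u <- iota 0 N | nth 0 T u == s] in
  all (fun u => all (fun v => all (fun u' => all (fun v' =>
    [&& u <= v, u' <= v' & v - u == v' - u'] ==> (diag_entry ds u v == diag_entry ds u' v'))
    top) top) top) top.

Definition realizable (T : seq nat) (ds : seq (seq nat)) : bool :=
  let N := size T in
  [&& well_sized N ds, nth [::] ds 0 == T, ~~ is_zero_seq (nth [::] ds 1),
      all (fun i => is_zero_seq (nth [::] ds i) || gorenstein_by_form (N.-1 - i) (nth [::] ds i))
          (iota 0 N),
      all (fun i => let D := shift_diff (N - i) (nth [::] ds i) (nth [::] ds i.+1) in
                    is_zero_seq D || plane_growth D) (iota 0 N),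
      entries_ok T ds & plateau_ok T ds].

Definition potential_diagonals (T : seq nat) := diagonal_lists T (size T).

Definition classification_ok (T : seq nat) (m : nat) : bool :=
  let L := potential_diagonals T in
  [&& size L == m, uniq L, all (realizable T) L & uniq (map (string_table (size T)) L)].

(** * Hilbert functions and their numerical tests *)

Lemma O_sequence_growth k D : O_sequence k D -> O_growth D.
Proof.
move=> [D0|[n [I [homI hI]]]]; first by rewrite /O_growth D0.
rewrite /O_growth; apply/orP; right; apply/and3P; split.
- by apply/allP => d _; apply/implyP => /eqP /(hilbert_eq0S homI hI) ->.
- by apply/allP => d _; apply/implyP => /andP[]; apply: hilbert_le1S homI hI _.
- by apply/implyP => D1; apply/allP => d _; apply: hilbert_two_generators homI hI _ D1.
Qed.

Lemma plane_growth_O_sequence k D : plane_growth D -> O_sequence k D.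
Proof.
move=> /andP[/eqP D0 /allP D_ok]; apply: plane_O_sequence => // d;
  (have [dD|Dd] := ltnP d (size D); [by have := D_ok d; rewrite mem_iota dD => /(_ isT)/andP[]|]).
- by rewrite nth_default.
- by rewrite [nth 0 D d.+1]nth_default ?min0n // ltnW.
Qed.

Lemma gorenstein_by_form_sequence k j H : gorenstein_by_form j H -> gorenstein_sequence k j H.
Proof. by move=> /and3P[sepF /eqP HE Hj]; apply: gorenstein_of_form HE Hj. Qed.

Lemma gorenstein_sequence_sym k j H : gorenstein_sequence k j H ->
  nth 0 H 0 = 1 /\ forall u, u <= j -> nth 0 H u = nth 0 H (j - u).
Proof.
move=> [sH Hj [I [agI hI]]]; have [homI _ _] := agI; split.
  exact: hilbert0 homI hI.
move=> u uj; apply: (gorenstein_hilbert_sym agI hI Hj _ uj).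
by rewrite nth_default // sH.
Qed.

(** * Diagonals of potential rank matrices *)

Section Diagonals.
Variables (N : nat) (M : 'M[nat]_N).

Lemma entry_ord (u v : 'I_N) : entry M u v = M u v.
Proof. by rewrite /entry !valK. Qed.

Lemma entry_out u v : N <= v -> entry M u v = 0.
Proof.
by move=> Nv; rewrite /entry [insub v]insubN -?leqNgt //; case: insub.
Qed.

Lemma nth_diagonal i u : nth 0 (diagonal M i) u = entry M u (u + i).
Proof.
have [uN|Nu] := ltnP u (N - i); first by rewrite nth_mkseq.
by rewrite nth_default ?size_mkseq // entry_out //; lia.
Qed.

Lemma diagonal_diffE i : diagonal_diff M i = shift_diff (N - i) (diagonal M i) (diagonal M i.+1).
Proof. by []. Qed.

End Diagonals.

Section NecessaryConditions.
Variables (k : fieldType) (T : seq nat) (M : 'M[nat]_(size T)).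
Hypothesis prm : potential_rank_matrix k M.
Hypothesis T1 : nth 0 T 1 <= 3.
Hypothesis T2 : nth 0 T 2 <= 6.
Hypothesis T_plateau : forall u, 1 < u -> u.+2 < size T -> nth 0 T u = \max_(t <- T) t.

Let N := size T.

Lemma diagonal_le i u : nth 0 (diagonal M i) u <= nth 0 T u.
Proof.
rewrite -{2}(prm_diagonal0 prm) !nth_diagonal addn0.
have [uiN|Nui] := ltnP (u + i) N; last by rewrite entry_out.
elim: i uiN => [|i IHi] uiN; first by rewrite addn0.
rewrite addnS in uiN *; apply: leq_trans (IHi (ltnW uiN)).
by apply: (prm_rows prm) => //; apply: leq_addr.
Qed.

(** Symmetry gives the last two terms from the first two; the plateau condition makes the
    terms in between equal. *)
Lemma diagonal_candidate i : 0 < i <= N -> diagonal M i \in diagonal_candidates N i.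
Proof.
move=> /andP[i0 iN]; rewrite /diagonal_candidates; case: ltnP => Ni; last first.
  by rewrite /diagonal (eqP Ni) mem_head.
rewrite mem_undup inE.
have [/all_pred1P ->|] := prm_gorenstein prm Ni; first by rewrite size_mkseq eqxx.
move=> G; have [H0 Hsym] := gorenstein_sequence_sym G; have [sH _ _] := G.
rewrite -/N in sH Hsym; set s := N.-1 - i in sH Hsym *; set H := diagonal M i in sH H0 Hsym *.
apply/orP; right; apply/allpairsP; exists (nth 0 H 1, nth 0 H 2).
rewrite !mem_iota !add0n !ltnS /= (leq_trans (diagonal_le i 1) T1) (leq_trans (diagonal_le i 2) T2).
split=> //; apply: (@eq_from_nth _ 0); first by rewrite sH size_mkseq.
move=> u; rewrite sH => us; rewrite [RHS]nth_mkseq //.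
have [->|u0] := eqVneq u 0; first by rewrite H0.
have [->|us'] := eqVneq u s; first by rewrite Hsym // subnn H0.
have [->|u1] := eqVneq u 1; first by [].
have [us1|us1] := eqVneq u s.-1.
  by rewrite Hsym // (_ : s - u = 1) //; lia.
rewrite /H !nth_diagonal.
apply: (prm_plateau prm); rewrite ?T_plateau -/N //; lia.
Qed.

Lemma next_diagonal_necessary i : 0 < i <= N ->
  next_diagonal_ok N i (diagonal M i.-2) (diagonal M i.-1) (diagonal M i).
Proof.
case: i => // i /andP[_ iN]; apply/and3P; split=> /=.
- by apply/implyP => /eqP[->]; apply: prm_diagonal1 prm.
- apply/allP => u; rewrite mem_iota add0n => /= uN; rewrite !nth_diagonal.
  apply/and3P; split.
  + by rewrite addnS; apply: (prm_rows prm); rewrite -/N; lia.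
  + by rewrite addSnnS; apply: (prm_columns prm); rewrite -/N; lia.
  + apply/implyP; rewrite ltnS => i0; case: i i0 uN {iN} => // i _ uN /=.
    by rewrite !addSnnS !addnS; apply: (prm_squares prm); rewrite -/N; lia.
- by rewrite -diagonal_diffE; apply: (@O_sequence_growth k); apply: prm_diff.
Qed.

Lemma diagonals_mem n : n <= N -> mkseq (diagonal M) n.+1 \in diagonal_lists T n.
Proof.
elim: n => [_|n IHn nN]; first by rewrite /mkseq /= (prm_diagonal0 prm) mem_head.
rewrite mkseqS; apply/flatten_mapP; exists (mkseq (diagonal M) n.+1); first exact/IHn/ltnW.
rewrite map_f // mem_filter !nth_mkseq // ?ltnS ?leq_pred //.
by rewrite diagonal_candidate //= andbT; apply: (@next_diagonal_necessary n.+1).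
Qed.

End NecessaryConditions.

(** * Matrices with given diagonals *)

Section Realization.
Variables (T : seq nat) (ds : seq (seq nat)).
Let N := size T.

Definition diagonal_matrix : 'M[nat]_(size T) := (\matrix_(u, v) diag_entry ds u v)%R.

Hypothesis ds_sized : well_sized N ds.

Lemma size_nth_diagonals i : size (nth [::] ds i) = N - i.
Proof.
have := congr1 (fun s => nth 0 s i) (eqP ds_sized).
have size_ds : size ds = N.+1 by rewrite -(size_map size) (eqP ds_sized) size_map size_iota.
have [iN|Ni _] := ltnP i N.+1; last by rewrite nth_default ?size_ds //=; lia.
by rewrite (nth_map [::]) ?size_ds // (nth_map 0) ?size_iota // nth_iota.
Qed.

Lemma entry_diagonal_matrix u v : entry diagonal_matrix u v = diag_entry ds u v.
Proof.
have [vN|Nv] := ltnP v N; last first.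
  rewrite entry_out // /diag_entry; case: ifP => // uv.
  by rewrite nth_default // size_nth_diagonals; lia.
have [uN|Nu] := ltnP u N.
  by rewrite -[u]/(val (Ordinal uN)) -[v]/(val (Ordinal vN)) entry_ord mxE.
by rewrite /entry [insub u]insubN -?leqNgt // /diag_entry leqNgt (leq_trans vN Nu).
Qed.

Lemma entry_above_diagonal_matrix u v :
  entry_above diagonal_matrix u v = diag_entry_above ds u v.
Proof. by case: u => //= u; apply: entry_diagonal_matrix. Qed.

Lemma string_mult_diagonal_matrix u v :
  string_mult diagonal_matrix u v = diag_string_mult ds u v.
Proof. by rewrite /string_mult !entry_diagonal_matrix !entry_above_diagonal_matrix. Qed.

Lemma diagonal_diagonal_matrix i : diagonal diagonal_matrix i = nth [::] ds i.
Proof.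
apply: (@eq_from_nth _ 0); first by rewrite size_mkseq size_nth_diagonals.
by move=> u _; rewrite nth_diagonal entry_diagonal_matrix /diag_entry leq_addr addKn.
Qed.

Lemma diagonals_diagonal_matrix : mkseq (diagonal diagonal_matrix) N.+1 = ds.
Proof.
have size_ds : size ds = N.+1 by rewrite -(size_map size) (eqP ds_sized) size_map size_iota.
apply: (@eq_from_nth _ [::]); first by rewrite size_mkseq.
by move=> i; rewrite size_mkseq => iN; rewrite nth_mkseq // diagonal_diagonal_matrix.
Qed.

End Realization.

Lemma realizable_potential k T ds : realizable T ds ->
  potential_rank_matrix k (diagonal_matrix T ds).
Proof.
move=> /and5P[sized /eqP ds0 ds1 /allP gor /and3P[/allP diff /allP ent plat]].
have E := entry_diagonal_matrix sized; have D := diagonal_diagonal_matrix sized.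
have ltN i : i < size T -> i \in iota 0 (size T) by rewrite mem_iota.
have entP u v (uN : u < size T) (vN : v < size T) :=
  and3P (allP (ent u (ltN u uN)) v (ltN v vN)).
split.
- by move=> u v vu; rewrite mxE /diag_entry leqNgt vu.
- by rewrite D.
- by rewrite D.
- move=> i iN; rewrite D; have /orP[->|/gorenstein_by_form_sequence] := gor i (ltN i iN).
    by left.
  by right.
- move=> i iN; rewrite diagonal_diffE !D.
  have /orP[z|/plane_growth_O_sequence] := diff i (ltN i iN); first by left.
  exact.
- move=> u v uv vN; have [/implyP H _ _] := entP u v (leq_ltn_trans uv (ltnW vN)) (ltnW vN).
  by rewrite !E H // uv.
- move=> u v uv vN; have [_ /implyP H _] := entP u v (ltn_trans uv vN) vN.
  by rewrite !E H.
- move=> u v uv vN; have [_ _ /implyP H] := entP u v (ltn_trans uv (ltnW vN)) (ltnW vN).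
  by rewrite !E H // uv.
move=> u v u' v' uv vN uv' vN' s Tu Tv Tu' Tv' vu; rewrite !E.
have sE : s = foldr maxn 0 T by rewrite foldrE.
have top w : w < size T -> nth 0 T w = s ->
    w \in [seq x <- iota 0 (size T) | nth 0 T x == foldr maxn 0 T].
  by move=> wN Tw; rewrite mem_filter ltN // Tw sE eqxx.
have := allP (allP (allP (allP plat u (top _ _ Tu)) v (top _ _ Tv))
  u' (top _ _ Tu')) v' (top _ _ Tv').
move=> H; apply/eqP; move: H => /(_ _ _ _ _)/implyP; apply; rewrite ?uv ?uv' ?vu ?eqxx //; lia.
Qed.

(** * Jordan degree types and the count *)

(** The pair [(v - u + 1, u)] determines [u] and [v], so one term of the double sum
    contributes. *)
Lemma jordan_degree_type_mult N (M : 'M[nat]_N) u v : u <= v -> v < N ->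
  jordan_degree_type M (v - u + 1, u) = string_mult M u v.
Proof.
move=> uv vN; pose x := (v - u + 1, u).
have morphD : {morph (fun A : {mset (nat * nat)}%mset => A x) : A B / (A `+` B)%mset >-> A + B}.
  by move=> A B; rewrite msetE2.
rewrite /jordan_degree_type -/x (big_morph _ morphD (mset0E x)).
have uN := leq_ltn_trans uv vN.
rewrite (bigD1 (Ordinal uN)) //= [X in _ + X]big1 ?addn0 => [|i iu]; last first.
  rewrite (big_morph _ morphD (mset0E x)) big1 // => l _; rewrite msetnE.
  by case: eqP => // -[_ iE]; case/eqP: iu; apply: val_inj.
rewrite (big_morph _ morphD (mset0E x)) (bigD1 (Ordinal vN)) //= msetnE eqxx.
rewrite big1 ?addn0 // => l /andP[ul lv]; rewrite msetnE.
case: eqP => // -[lE]; case/eqP: lv; apply: val_inj => /=; lia.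
Qed.

Lemma uniq_map_inj (A B : eqType) (f : A -> B) (s : seq A) :
  uniq (map f s) -> {in s &, injective f}.
Proof.
elim: s => //= a s IHs /andP[fa /IHs f_inj] x y.
rewrite !inE => /orP[/eqP->|xs] /orP[/eqP->|ys] // E; last exact: f_inj.
- by rewrite E map_f in fa.
- by rewrite -E map_f in fa.
Qed.

(** The search finds every potential rank matrix, and whatever it finds passes the
    sufficient tests; the Jordan degree types are distinct because the tables of string
    multiplicities are. *)
Lemma classification (k : fieldType) (T : seq nat) (m : nat) :
    classification_ok T m ->
    nth 0 T 1 <= 3 -> nth 0 T 2 <= 6 ->
    (forall u, 1 < u -> u.+2 < size T -> nth 0 T u = \max_(t <- T) t) ->
  has_card (potential_jordan_degree_type k T) m /\ has_card (@potential_rank_matrix k T) m.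
Proof.
move=> /and4P[/eqP size_L uniq_L /allP real_L uniq_tables] T1 T2 T_plateau.
set L := potential_diagonals T in size_L uniq_L real_L uniq_tables.
have sized ds : ds \in L -> well_sized (size T) ds by move=> /real_L/andP[].
have prmP M : M \in map (diagonal_matrix T) L <-> potential_rank_matrix k M.
  split=> [/mapP[ds /real_L/realizable_potential H ->] //|prm].
  have dsL := diagonals_mem prm T1 T2 T_plateau (leqnn _).
  apply/mapP; exists (mkseq (diagonal M) (size T).+1) => //; apply/matrixP => u v.
  rewrite mxE /diag_entry; case: leqP => [uv|]; last exact: (prm_upper prm).
  rewrite nth_mkseq ?nth_diagonal ?subnKC ?entry_ord //.
  by rewrite ltnS (leq_trans (leq_subr _ _)) // ltnW.
have jdt_inj : {in L &, injective (fun ds => jordan_degree_type (diagonal_matrix T ds))}.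
  move=> ds ds' dsL dsL' E; apply: (uniq_map_inj uniq_tables) => //.
  have mult u v : u <= v -> v < size T -> diag_string_mult ds u v = diag_string_mult ds' u v.
    move=> uv vN.
    by rewrite -!(string_mult_diagonal_matrix (sized _ _)) // -!jordan_degree_type_mult // E.
  apply/eq_in_allpairs_dep => u _ v; rewrite mem_iota => /= vN.
  by case: leqP => // uv; apply: mult.
split.
  exists (map (@jordan_degree_type _) (map (diagonal_matrix T) L)); split.
  - by rewrite -map_comp map_inj_in_uniq.
  - by rewrite !size_map.
  - move=> J; split=> [/mapP[M /prmP ? ->]|[M /prmP ? ->]]; first by exists M.
    exact: map_f.
exists (map (diagonal_matrix T) L); split=> //; last by rewrite size_map.
rewrite map_inj_in_uniq // => ds ds' /sized dsS /sized dsS' E.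
by rewrite -(diagonals_diagonal_matrix dsS) E diagonals_diagonal_matrix.
Qed.

Theorem theorem3p10 (k : fieldType)
    (k_infinite : forall s : seq k, exists x : k, x \notin s) :
  (has_card (potential_jordan_degree_type k (T_1_3_6k_3_1 3)) 52 /\
   has_card (@potential_rank_matrix k (T_1_3_6k_3_1 3)) 52) /\
  (has_card (potential_jordan_degree_type k (T_1_3_6k_3_1 4)) 61 /\
   has_card (@potential_rank_matrix k (T_1_3_6k_3_1 4)) 61).
Proof.
split; apply: classification => //; try by vm_compute.
- by case=> [|[|[|[|[|[|u]]]]]] //= _ _; rewrite -foldrE.
- by case=> [|[|[|[|[|[|u]]]]]] //= _ _; rewrite -foldrE.
Qed.
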